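(* Let $X$ be a compact Skula space and let $\mathcal U=\{U_x:x\in X\}$ be a clopen selector for $X$; order $X$ by $x\le y$ iff $U_x\subseteq U_y$, and let $H(X)$ be the corresponding hyperspace, ordered by inclusion. Then: (1) $\mathrm{ht}(X)\le \mathrm{rk}(X)<\omega^{\mathrm{ht}(X)+1}$. (2) $\mathrm{rk}(H(X))\le\omega^{\mathrm{rk}(X)}$.
   Context: A Hausdorff space $X$ is a Skula space if its topology is generated by the base $\{U\setminus V : U,V\in\mathcal T\}$ for some topology $\mathcal T$ on $X$. A clopen selector for $X$ is a family $\{U_x : x\in X\}$ of clopen subsets of $X$ such that: (1) $x\in U_x$ for every $x$; (2) for distinct $x,y$, either $x\notin U_y$ or $y\notin U_x$; (3) if $y\in U_x$ then $U_y\subseteq U_x$. $H(X)$ is the set of all nonempty closed initial (downward closed) subsets of $(X,\le)$, ordered by inclusion. The posets $X$ and $H(X)$ are well-founded, and compact Skula spaces are scattered. Cantor–Bendixson height: $X^{[0]}=X$, and for $\alpha>0$, $X^{[\alpha]}=\bigcap_{\beta<\alpha}(X^{[\beta]})^{[1]}$, where $A^{[1]}$ is the set of non-isolated points of the subspace $A$. For scattered $X$ and $x\in X$, $\mathrm{ht}_X(x)=\alpha$ iff $x\in X^{[\alpha]}\setminus X^{[\alpha+1]}$; and $\mathrm{ht}(X)=\sup_{x\in X}\mathrm{ht}_X(x)$. Well-founded rank: for a well-founded poset $W$, $\mathrm{rk}_W(p)=\sup\{\mathrm{rk}_W(q)+1: q<p\}$ and $\mathrm{rk}(W)=\sup\{\mathrm{rk}_W(p)+1:p\in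 W\}$. Exponentiation is ordinal exponentiation. *)

(* Defs.v *)
From mathcomp Require Import all_boot all_order.
From mathcomp Require Import boolp classical_sets functions cardinality filter.
From mathcomp Require Import topology.

Set Implicit Arguments.
Unset Strict Implicit.
Unset Printing Implicit Defensive.

Local Open Scope classical_set_scope.

(* Ordinals, presented as well-founded trees: [olim f] is the least ordinal
   strictly above all the [f a].  One ordinal has many presentations, so
   equality of ordinals is [oeq], not Leibniz equality; by [ole_or_gt] and
   [olt_wf] the quotient is a well-ordered class, and by [osup] it has the
   suprema of all families indexed by a type. *)
Inductive ord : Type := olim (A : Type) (f : A -> ord).

Fixpoint ole (x y : ord) {struct x} : Prop :=
  match x, y with
  | olim A f, olim B g => forall a, exists b, ole (f a) (g b)
  end.

Definition olt (x y : ord) : Prop :=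
  match y with olim B g => exists b, ole x (g b) end.

Definition oeq (x y : ord) : Prop := ole x y /\ ole y x.

Definition ozero : ord := olim (fun e : Empty_set => match e with end).

Definition osucc (x : ord) : ord := olim (fun _ : unit => x).

Definition oidx (x : ord) : Type := match x with olim A _ => A end.

Definition osub (x : ord) : oidx x -> ord := match x with olim _ f => f end.

Definition osup (A : Type) (f : A -> ord) : ord :=
  olim (fun p : {a : A & oidx (f a)} => osub (projT2 p)).

Arguments osup : simpl never.

Fixpoint onat (n : nat) : ord := if n is m.+1 then osucc (onat m) else ozero.

Definition omega : ord := olim onat.

Fixpoint oadd (x y : ord) {struct y} : ord :=
  match y with
  | olim B g =>
    osup (fun o : option B => if o is Some b then osucc (oadd x (g b)) else x)
  end.

Fixpoint omul (x y : ord) {struct y} : ord :=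
  match y with olim B g => osup (fun b => oadd (omul x (g b)) x) end.

(* [x ^ y = max 1 (sup_{z < y} x ^ z * x)], which is ordinal exponentiation
   for bases [x > 0]; see [oexp0], [oexpS] and [oexp_limit]. *)
Fixpoint oexp (x y : ord) {struct y} : ord :=
  match y with
  | olim B g =>
    osup (fun o : option B =>
            if o is Some b then omul (oexp x (g b)) x else osucc ozero)
  end.

Lemma ole_refl x : ole x x.
Proof. by elim: x => A f IH /= a; exists a. Qed.

Lemma ole_trans x y z : ole x y -> ole y z -> ole x z.
Proof.
elim: x y z => A f IH [B g] [C h] /= xy yz a.
have [b ab] := xy a; have [c bc] := yz b.
by exists c; exact: (IH _ _ _ ab bc).
Qed.

Lemma ole_limP A (f : A -> ord) y : ole (olim f) y <-> forall a, olt (f a) y.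
Proof. by case: y. Qed.

Lemma olt_le_trans x y z : olt x y -> ole y z -> olt x z.
Proof.
case: y z => [B g] [C h] /= [b xb] yz; have [c bc] := yz b.
by exists c; exact: ole_trans bc.
Qed.

Lemma ole_lt_trans x y z : ole x y -> olt y z -> olt x z.
Proof.
by case: z => [C h] /= xy [c yc]; exists c; exact: ole_trans yc.
Qed.

Lemma oltW x y : olt x y -> ole x y.
Proof.
elim: x y => A f IH [B g] [b /ole_limP xb] a.
by exists b; exact: IH.
Qed.

Lemma olt_wf : well_founded olt.
Proof.
suff acc x y : ole y x -> Acc olt y by move=> x; exact: acc (ole_refl x).
elim: x y => A f IH y yx; constructor => z /olt_le_trans /(_ yx) [a za].
exact: IH za.
Qed.

Lemma olt_irr x : ~ olt x x.
Proof. by elim: (olt_wf x) => {}x _ IH xx; exact: (IH x xx xx). Qed.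

Lemma ole_or_gt x y : ole x y \/ olt y x.
Proof.
elim: x y => A f IH y; case: (pselect (exists a, ole y (f a))) => [h|h].
  by right.
left; apply/ole_limP => a.
elim: y h => B g IHg h /=; apply: contrapT => nb; apply: h; exists a.
apply/ole_limP => b; have [ab|//] := IH a (g b).
by case: nb; exists b.
Qed.

Lemma ole_succP x y : ole (osucc x) y <-> olt x y.
Proof. by split=> [/ole_limP/(_ tt)|h]; last exact/ole_limP. Qed.

Lemma olt_succP x y : olt x (osucc y) <-> ole x y.
Proof. by split=> [[]|h] //; exists tt. Qed.

Lemma osup_leP A (f : A -> ord) y : ole (osup f) y <-> forall a, ole (f a) y.
Proof.
split=> [/ole_limP h a|h].
- have {}h (i : oidx (f a)) : olt (osub i) y.
    exact: (h (existT (fun a => oidx (f a)) a i)).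
  by case: (f a) h => B g h; exact/ole_limP.
- apply/ole_limP => -[a i] /=; have := h a.
  by move: i; case: (f a) => B g b /ole_limP /(_ b).
Qed.

Lemma ole_sup A (f : A -> ord) a : ole (f a) (osup f).
Proof. by move: a; apply/osup_leP; exact: ole_refl. Qed.

Lemma olt_supP A (f : A -> ord) x : olt x (osup f) <-> exists a, olt x (f a).
Proof.
split=> [[[a i] xi]|[a xa]]; last exact: olt_le_trans xa (ole_sup f a).
by exists a; move: i xi => /=; case: (f a) => B g b xb; exists b.
Qed.

Arguments ole : simpl never.
Arguments olt : simpl never.

Lemma ozero_le x : ole ozero x.
Proof. by apply/ole_limP => -[]. Qed.

Lemma ole_add_l x y : ole x (oadd x y).
Proof. by case: y => B g; exact: (ole_sup _ None). Qed.

Lemma ole_add x x' y y' : ole x x' -> ole y y' -> ole (oadd x y) (oadd x' y').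
Proof.
move=> xx'; elim: y y' => B g IH [C h] /= yy'; apply/osup_leP => -[b|].
- have [c bc] := yy' b; apply: ole_trans (ole_sup _ (Some c)).
  by apply/ole_succP/olt_succP; exact: IH.
- exact: ole_trans xx' (ole_sup _ None).
Qed.

Lemma oadd0 x : oeq (oadd x ozero) x.
Proof.
split; last exact: ole_add_l.
by apply/osup_leP => -[[]|]; exact: ole_refl.
Qed.

Lemma oaddS x y : oeq (oadd x (osucc y)) (osucc (oadd x y)).
Proof.
split; last exact: (ole_sup _ (Some tt)).
apply/osup_leP => -[_|]; first exact: ole_refl.
by apply: ole_trans (ole_add_l x y) _; apply/oltW/olt_succP; exact: ole_refl.
Qed.

Definition olimit (y : ord) : Prop :=
  olt ozero y /\ forall z, olt z y -> olt (osucc z) y.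

Lemma oadd_limit x y : olimit y -> forall w,
  ole (oadd x y) w <-> forall z, olt z y -> ole (oadd x z) w.
Proof.
move=> [y0 yS] w; split=> [h z /oltW zy|h].
  by apply: ole_trans h; apply: ole_add => //; exact: ole_refl.
case: y y0 yS h => B g y0 yS h; apply/osup_leP => -[b|].
- apply: (ole_trans (oaddS x (g b)).2); apply: h; apply: yS.
  by exists b; exact: ole_refl.
- by apply: ole_trans (h _ y0); exact: ole_add_l.
Qed.

Lemma ole_mul x x' y y' : ole x x' -> ole y y' -> ole (omul x y) (omul x' y').
Proof.
move=> xx'; elim: y y' => B g IH [C h] /= yy'; apply/osup_leP => b.
have [c bc] := yy' b; apply: ole_trans (ole_sup _ c).
by apply: ole_add => //; exact: IH.
Qed.

Lemma omul0 x : oeq (omul x ozero) ozero.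
Proof. by split; [apply/osup_leP => -[]|exact: ozero_le]. Qed.

Lemma omulS x y : oeq (omul x (osucc y)) (oadd (omul x y) x).
Proof.
split; last exact: (ole_sup _ tt).
by apply/osup_leP => _; exact: ole_refl.
Qed.

Lemma omul_limit x y : olimit y -> forall w,
  ole (omul x y) w <-> forall z, olt z y -> ole (omul x z) w.
Proof.
move=> [_ yS] w; split=> [h z /oltW zy|h].
  by apply: ole_trans h; apply: ole_mul => //; exact: ole_refl.
case: y yS h => B g yS h; apply/osup_leP => b.
apply: (ole_trans (omulS x (g b)).2); apply: h; apply: yS.
by exists b; exact: ole_refl.
Qed.

Lemma ole_exp x x' y y' : ole x x' -> ole y y' -> ole (oexp x y) (oexp x' y').
Proof.
move=> xx'; elim: y y' => B g IH [C h] /= yy'; apply/osup_leP => -[b|].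
- have [c bc] := yy' b; apply: ole_trans (ole_sup _ (Some c)).
  by apply: ole_mul => //; exact: IH.
- exact: (ole_sup _ None).
Qed.

Lemma oexp_gt0 x y : olt ozero (oexp x y).
Proof. by case: y => B g; apply/ole_succP; exact: (ole_sup _ None). Qed.

Lemma oexp0 x : oeq (oexp x ozero) (osucc ozero).
Proof.
split; last exact: (ole_sup _ None).
by apply/osup_leP => -[[]|]; exact: ole_refl.
Qed.

Lemma oadd0_ge x : ole x (oadd ozero x).
Proof.
elim: x => A f IH; apply/ole_limP => a.
apply: olt_le_trans (ole_sup _ (Some a)); exact/olt_succP.
Qed.

Lemma oexpS x y : olt ozero x -> oeq (oexp x (osucc y)) (omul (oexp x y) x).
Proof.
move=> x0; split; last exact: (ole_sup _ (Some tt)).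
apply/osup_leP => -[_|]; first exact: ole_refl.
have /ole_succP e0 := oexp_gt0 x y; apply: (ole_trans e0).
have /ole_succP x1 := x0.
apply: ole_trans (ole_mul (ole_refl (oexp x y)) x1).
apply: ole_trans (ole_sup _ tt).
apply: (ole_trans (oadd0_ge _)); apply: ole_add (ole_refl _).
exact: ozero_le.
Qed.

Lemma oexp_limit x y : olt ozero x -> olimit y -> forall w,
  ole (oexp x y) w <-> forall z, olt z y -> ole (oexp x z) w.
Proof.
move=> x0 [y0 yS] w; split=> [h z /oltW zy|h].
  by apply: ole_trans h; apply: ole_exp => //; exact: ole_refl.
case: y y0 yS h => B g y0 yS h; apply/osup_leP => -[b|].
- apply: (ole_trans (oexpS (g b) x0).2); apply: h; apply: yS.
  by exists b; exact: ole_refl.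
- by apply: ole_trans (h _ y0); exact: (oexp0 x).2.
Qed.

Definition strict (W : Type) (le : W -> W -> Prop) (p q : W) : Prop :=
  le p q /\ p <> q.

Definition point_rank (W : Type) (le : W -> W -> Prop)
    (wf : well_founded (strict le)) : W -> ord :=
  Fix wf (fun _ => ord) (fun p rk =>
    osup (fun q : {q | strict le q p} => osucc (rk (sval q) (svalP q)))).

Definition rank (W : Type) (le : W -> W -> Prop)
    (wf : well_founded (strict le)) : ord :=
  osup (fun p => osucc (point_rank wf p)).

Lemma point_rankE (W : Type) (le : W -> W -> Prop)
    (wf : well_founded (strict le)) (p : W) :
  point_rank wf p =
  osup (fun q : {q | strict le q p} => osucc (point_rank wf (sval q))).
Proof.
rewrite /point_rank Fix_eq // => {}p f g fg.
by congr osup; apply/funext => q; rewrite fg.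
Qed.

Definition derived (X : topologicalType) (A : set X) : set X :=
  A `\` isolated A.

(* [cb_derivative X a] is the [a]-th Cantor-Bendixson derivative of [X]; the
   intersection over all smaller ordinals is [cb_derivativeE]. *)
Fixpoint cb_derivative (X : topologicalType) (a : ord) : set X :=
  match a with
  | olim A f => \bigcap_(i in [set: A]) derived (@cb_derivative X (f i))
  end.

Arguments cb_derivative : clear implicits.

Lemma derivedS (X : topologicalType) (A B : set X) :
  A `<=` B -> derived A `<=` derived B.
Proof.
move=> AB x [Ax nA]; split; first exact: AB.
move=> [_ [V Vx VB]]; apply: nA; split; first exact/mem_set.
exists V => //; apply/seteqP; split=> y; last first.
  by move=> ->; split=> //; exact: nbhs_singleton.
by move=> [Vy /AB By]; rewrite -VB.
Qed.

Lemma cb_derivativeS (X : topologicalType) (a b : ord) :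
  ole a b -> cb_derivative X b `<=` cb_derivative X a.
Proof.
elim: a b => A f IH [B g] /= ab x bx i _.
have [j ij] := ab i; exact: derivedS (IH _ _ ij) _ (bx j I).
Qed.

Lemma cb_derivativeE (X : topologicalType) (a : ord) :
  cb_derivative X a =
  [set x | forall b, olt b a -> derived (cb_derivative X b) x].
Proof.
apply/seteqP; case: a => A f; split=> x /= h.
- by move=> b [i bi]; apply: derivedS (h i I); exact: cb_derivativeS.
- by move=> i _; apply: h; exists i; exact: ole_refl.
Qed.

Definition has_height (X : topologicalType) (x : X) (a : ord) : Prop :=
  (cb_derivative X a `\` cb_derivative X (osucc a)) x.

(* Well defined up to [oeq] by [has_height_uniq].  The value [ozero] on points
   in no [X^[a] \ X^[a+1]] is junk, never used when [X] is scattered. *)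
Definition point_height (X : topologicalType) (x : X) : ord :=
  if pselect (exists a, has_height x a) is left e then sval (cid e) else ozero.

Definition height (X : topologicalType) : ord := osup (@point_height X).

Lemma has_height_uniq (X : topologicalType) (x : X) (a b : ord) :
  has_height x a -> has_height x b -> oeq a b.
Proof.
suff le c d : has_height x c -> has_height x d -> ole c d.
  by move=> ha hb; split; exact: le.
move=> [hc _] [_ hd]; have [//|/ole_succP dc] := ole_or_gt c d.
by case: hd; exact: cb_derivativeS dc _ hc.
Qed.

Record is_topology (X : Type) (T : set (set X)) : Prop := IsTopology {
  topology_setT : T [set: X];
  topology_setI : setI_closed T;
  topology_bigcup : forall F : set (set X),
    F `<=` T -> T (\bigcup_(A in F) A) }.

Definition skula (X : topologicalType) : Prop :=
  hausdorff_space X /\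
  exists2 T : set (set X), is_topology T &
    basis [set W : set X | exists U V, [/\ T U, T V & W = U `\` V]].

Record clopen_selector (X : topologicalType) (U : X -> set X) : Prop :=
  ClopenSelector {
    selector_clopen : forall x, clopen (U x);
    selector_refl : forall x, U x x;
    selector_anti : forall x y, x <> y -> ~ U y x \/ ~ U x y;
    selector_trans : forall x y, U x y -> U y `<=` U x }.

Definition sel_le (X : topologicalType) (U : X -> set X) (x y : X) : Prop :=
  U x `<=` U y.

Record hyperspace (X : topologicalType) (U : X -> set X) : Type := Hyperspace {
  hset : set X;
  hset_neq0 : hset !=set0;
  hset_closed : closed hset;
  hset_initial : forall x y, hset x -> sel_le U y x -> hset y }.

Definition hyp_le (X : topologicalType) (U : X -> set X)
  (F G : hyperspace U) : Prop := hset F `<=` hset G.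

Lemma sel_leP (X : topologicalType) (U : X -> set X) :
  clopen_selector U -> forall x y, sel_le U x y <-> U y x.
Proof.
move=> hU x y; split; last exact: selector_trans.
by move=> /(_ _ (selector_refl hU x)).
Qed.

Lemma sel_le_anti (X : topologicalType) (U : X -> set X) :
  clopen_selector U -> forall x y, sel_le U x y -> sel_le U y x -> x = y.
Proof.
move=> hU x y /(sel_leP hU) xy /(sel_leP hU) yx; apply: contrapT => nxy.
by have [|] := selector_anti hU nxy.
Qed.

Lemma hyp_le_anti (X : topologicalType) (U : X -> set X) (F G : hyperspace U) :
  hyp_le F G -> hyp_le G F -> F = G.
Proof.
case: F G => [F F0 cF iF] [G G0 cG iG] FG GF.
have E : F = G by exact/seteqP.
move: G0 cG iG {FG GF}; rewrite -{}E => G0 cG iG.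
by congr Hyperspace; exact: Prop_irrelevance.
Qed.

Lemma descending_chain (W : Type) (R : W -> W -> Prop) :
  (forall s : nat -> W, ~ forall n, R (s n.+1) (s n)) -> well_founded R.
Proof.
move=> nos x0; apply: contrapT => nx0.
have next (x : {x | ~ Acc R x}) :
    exists y : {x | ~ Acc R x}, R (sval y) (sval x).
  case: x => x nx /=; apply: contrapT => ny; apply: nx; constructor => y yx.
  by apply: contrapT => nAy; apply: ny; exists (exist _ y nAy).
have [f fP] := choice next.
by apply: (nos (fun n => sval (iter n f (exist _ x0 nx0)))) => n /=; exact: fP.
Qed.

Lemma seq_cluster (X : topologicalType) (s : nat -> X) :
  compact [set: X] -> exists x : X, forall (n : nat) (V : set X), nbhs x V ->
    exists2 m, (n <= m)%N & V (s m).
Proof.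
move=> cX; have [x [_ xs]] := cX (fmap s eventually) _ filterT.
exists x => n V Vx.
have : fmap s eventually (s @` [set m | (n <= m)%N]).
  by exists n => // m /= nm; exists m.
by move=> /xs /(_ Vx) [_ [[m nm <-] Vm]]; exists m.
Qed.

Lemma sel_wf (X : topologicalType) (U : X -> set X) :
  compact [set: X] -> clopen_selector U -> well_founded (strict (sel_le U)).
Proof.
move=> cX hU; apply: descending_chain => s sdec.
have mono n m : (n <= m)%N -> sel_le U (s m) (s n).
  elim: m => [|m IH]; first by rewrite leqn0 => /eqP ->.
  rewrite leq_eqVlt => /predU1P[->|/IH h]; first by [].
  exact: subset_trans (sdec m).1 h.
have [x xs] := seq_cluster s cX.
have xU n : U (s n) x.
  apply: contrapT => nx; have [_ cl] := selector_clopen hU (s n).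
  have [m nm] := xs n _ (open_nbhs_nbhs (conj (closed_openC cl) nx)).
  by apply; apply/(sel_leP hU); exact: mono.
have [oU _] := selector_clopen hU x.
have [m _ xm] := xs 0%N _ (open_nbhs_nbhs (conj oU (selector_refl hU x))).
apply: (sdec m).2; apply: (sel_le_anti hU); first exact: (sdec m).1.
apply: subset_trans (selector_trans hU (xU m.+1)).
exact: selector_trans xm.
Qed.

Lemma hyp_wf (X : topologicalType) (U : X -> set X) :
  compact [set: X] -> clopen_selector U ->
  well_founded (strict (@hyp_le X U)).
Proof.
move=> cX hU; apply: descending_chain => s sdec.
have mono n m : (n <= m)%N -> hset (s m) `<=` hset (s n).
  elim: m => [|m IH]; first by rewrite leqn0 => /eqP ->.
  rewrite leq_eqVlt => /predU1P[->|/IH h]; first by [].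
  exact: subset_trans (sdec m).1 h.
have diff n : exists x, hset (s n) x /\ ~ hset (s n.+1) x.
  apply: contrapT => nx; apply: (sdec n).2.
  apply: hyp_le_anti; first exact: (sdec n).1.
  by move=> x snx; apply: contrapT => nsx; apply: nx; exists x.
have [t tP] := choice diff; have [x xt] := seq_cluster t cX.
have xs n : hset (s n) x.
  apply: contrapT => nx.
  have [m nm] := xt n _
    (open_nbhs_nbhs (conj (closed_openC (@hset_closed _ _ (s n))) nx)).
  by apply; apply: (mono _ _ nm); exact: (tP m).1.
have [oU _] := selector_clopen hU x.
have [m _ xm] := xt 0%N _ (open_nbhs_nbhs (conj oU (selector_refl hU x))).
apply: (tP m).2; apply: hset_initial (xs m.+1) _; exact/(sel_leP hU).
Qed.

Lemma point_heightP (X : topologicalType) (U : X -> set X) :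
  compact [set: X] -> clopen_selector U ->
  forall x : X, has_height x (point_height x).
Proof.
move=> cX hU x; rewrite /point_height; case: pselect => [e|ne].
  exact: svalP (cid e).
have all_x a : cb_derivative X a x.
  elim: (olt_wf a) => {}a _ IH; rewrite cb_derivativeE => b ba.
  apply: contrapT => nx; apply: ne; exists b; split; first exact: IH.
  by rewrite /= => /(_ tt I).
have [h hP] : exists h : X -> ord, forall y,
    (exists a, ~ cb_derivative X a y) -> ~ cb_derivative X (h y) y.
  have pt (y : X) : {a : ord | (exists a, ~ cb_derivative X a y) ->
                                ~ cb_derivative X a y}.
    apply: cid; have [[a na]|n] := pselect (exists a, ~ cb_derivative X a y).
      by exists a.
    by exists ozero => /n.
  by exists (fun y => sval (pt y)) => y; exact: svalP (pt y).
pose K := cb_derivative X (osup h).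
have KE y : K y -> forall a, cb_derivative X a y.
  move=> Ky a; apply: contrapT => na; apply: (hP y); first by exists a.
  exact: cb_derivativeS (ole_sup h y) _ Ky.
suff [y [Ky isoy]] : exists y, K y /\ isolated K y.
  by have /= /(_ tt I) [] := KE y Ky (osucc (osup h)).
have : K x by exact: all_x.
elim: (sel_wf cX hU x) => {}x _ IH Kx {all_x ne}.
case: (pselect (exists2 y, strict (sel_le U) y x & K y)) => [[y yx]|nmin].
  exact: IH.
exists x; split => //; split; first exact/mem_set.
have [oU _] := selector_clopen hU x.
exists (U x); first exact: open_nbhs_nbhs (conj oU (selector_refl hU x)).
apply/seteqP; split=> y; last by move=> ->; split=> //; exact: selector_refl.
move=> [xy Ky]; apply: contrapT => nyx; apply: nmin; exists y => //.
by split=> //; exact/(sel_leP hU).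
Qed.

(* Main.v *)
Require Import Defs.
From mathcomp Require Import all_boot boolp classical_sets topology.

(** Write [rk] for the rank in [X]. The rank of [X] is at least its height
    because every point [x] of [X^[a]] has [a <= rk x]: for [b < a] the
    neighbourhood [U x] of the non-isolated point [x] of [X^[b]] contains
    another point of [X^[b]], which lies strictly below [x].

    Both upper bounds rest on removing, one at a time, finitely many points of
    maximal height or rank, and on the additive indecomposability of [omega ^
    a] ([oadd_lt_oexp]). A chain is cut by a removed point in a lower and an
    upper part, so each removal at most doubles the available bound, up to a
    successor; and finitely many such doublings applied to [omega ^ b] stay
    below [omega ^ a] whenever [b < a] ([oexp_double_lt]).

    For the rank of [X], the statement proved by induction on [a]
    ([rank_on_lt_oexp_cb]) is that a clopen [L] disjoint from [X^[a]], with the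
    induced order, has rank below [omega ^ a]. By compactness [L], unless it is
    empty, already misses the set of non-isolated points of [X^[b]] for some [b
    < a]; as [L `&` X^[b]] is compact and discrete, [L] meets [X^[b]] in
    finitely many points. If [x] is one of them, [L] is the union of its
    initial part [L `&` U x], in which every point other than [x] has a
    down-set avoiding [x], and of the clopen set [L `\` U x], also avoiding [x]
    ([rank_on_lt_double]). Taking [L = X] and [a = height X + 1] gives the
    bound.

    For the rank of [H(X)], a chain of closed initial sets below [G] splits at
    the first member that contains a given [x]: before it, the sets avoid [x];
    from then on, they contain [U x], and one may measure them relative to this
    set ([hyp_rank_above_lt_double]). The statement proved by induction on [a]
    ([hyp_rank_above_lt_oexp]) is therefore relative to an open set [B]: if all
    points of [G `\` B] have rank below [a], then [G] has rank below [omega ^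
    a] in the poset of closed initial sets that contain [B]. By compactness [G
    `\` B] is covered by finitely many [U x] with [x] in [G `\` B]; hence,
    unless it is empty, ranks have a maximum on it, which is attained only at
    such [x]. *)

Set Implicit Arguments.
Unset Strict Implicit.
Unset Printing Implicit Defensive.

Local Open Scope classical_set_scope.

(** * Ordinals and powers of omega *)

Lemma olt_oadd2l x y z : olt y z -> olt (oadd x y) (oadd x z).
Proof.
move=> /ole_succP yz; apply/ole_succP.
exact: ole_trans (oaddS x y).2 (ole_add (ole_refl x) yz).
Qed.

Lemma oadd0l_le x : ole (oadd ozero x) x.
Proof.
elim: x => A f IH; apply/osup_leP => -[a|]; last exact: ozero_le.
by apply/ole_succP; exists a; exact: IH.
Qed.

Lemma oadd_assoc_le x y z : ole (oadd x (oadd y z)) (oadd (oadd x y) z).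
Proof.
elim: z => C h IH; apply/osup_leP => -[[[c|] i]|] /=.
- apply/ole_succP; apply: olt_le_trans (ole_sup _ (Some c)).
  by apply/olt_succP; exact: IH.
- apply/ole_succP; apply: olt_le_trans (ole_sup _ None).
  by apply: olt_oadd2l; case: y {IH} i => B g b; exists b; exact: ole_refl.
- exact: ole_trans (ole_add_l x y) (ole_sup _ None).
Qed.

Lemma omul_onatD x n m :
  ole (oadd (omul x (onat n)) (omul x (onat m))) (omul x (onat (n + m))).
Proof.
elim: m => [|m IH].
  rewrite addn0; apply: ole_trans (oadd0 _).1.
  exact: ole_add (ole_refl _) (omul0 x).1.
rewrite addnS; apply: ole_trans (omulS _ _).2.
apply: ole_trans (ole_add IH (ole_refl x)).
apply: ole_trans (oadd_assoc_le _ _ _).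
exact: ole_add (ole_refl _) (omulS _ _).1.
Qed.

Lemma olt_omul_omega x y :
  olt x (omul y omega) -> exists n, ole x (omul y (onat n)).
Proof.
move=> /olt_supP[n xn]; exists n.+1.
exact: ole_trans (oltW xn) (omulS y (onat n)).2.
Qed.

(** The only ordinal below [omega ^ a] that is not bounded by a finite multiple
    of a smaller power is [0], when [a = 0]; listing [0] separately avoids
    distinguishing zero, successor and limit exponents. *)
Lemma olt_oexp_omega x a : olt x (oexp omega a) ->
  ole x ozero \/ exists2 b, olt b a &
    exists n, ole x (omul (oexp omega b) (onat n)).
Proof.
case: a => A f /olt_supP[[i|] xi]; last by left; exact/olt_succP.
right; exists (f i); first by exists i; exact: ole_refl.
exact: olt_omul_omega.
Qed.

Lemma omul_onat_lt_oexp b a n :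
  olt b a -> olt (omul (oexp omega b) (onat n)) (oexp omega a).
Proof.
case: a => A f [i bi].
apply: (@olt_le_trans _ (omul (oexp omega (f i)) omega)); last first.
  exact: (ole_sup _ (Some i)).
apply: (@ole_lt_trans _ (omul (oexp omega (f i)) (onat n))).
  by apply: ole_mul (ole_refl _); exact: ole_exp (ole_refl _) bi.
apply/olt_supP; exists n; apply: ole_lt_trans (oadd0 _).2 _.
exact/olt_oadd2l/oexp_gt0.
Qed.

Lemma olt_oexp2l b a : olt b a -> olt (oexp omega b) (oexp omega a).
Proof.
move=> ba; apply: ole_lt_trans (omul_onat_lt_oexp 1 ba).
apply: (ole_trans (oadd0_ge _)).
apply: ole_trans (omulS _ ozero).2.
by apply: ole_add (ole_refl _); exact: ozero_le.
Qed.

(** Additive indecomposability: both terms are bounded by finite multiples of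
    one and the same power [omega ^ d] with [d < a], and multiples add up. *)
Lemma oadd_lt_oexp x y a : olt x (oexp omega a) -> olt y (oexp omega a) ->
  olt (oadd x y) (oexp omega a).
Proof.
move=> xa ya.
have [x0|[b ba [n xn]]] := olt_oexp_omega xa.
  apply: ole_lt_trans ya; apply: ole_trans (oadd0l_le y).
  exact: ole_add x0 (ole_refl y).
have [y0|[c ca [m ym]]] := olt_oexp_omega ya.
  apply: ole_lt_trans xa; apply: ole_trans (oadd0 x).1.
  exact: ole_add (ole_refl x) y0.
have [d [da bd cd]] : exists d, [/\ olt d a, ole b d & ole c d].
  have [bc|cb] := ole_or_gt b c; first by exists c; split=> //; exact: ole_refl.
  by exists b; split=> //; [exact: ole_refl|exact: oltW].
apply: ole_lt_trans (omul_onat_lt_oexp (n + m) da).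
apply: ole_trans (omul_onatD _ _ _).
apply: ole_add.
  exact: ole_trans xn (ole_mul (ole_exp (ole_refl _) bd) (ole_refl _)).
exact: ole_trans ym (ole_mul (ole_exp (ole_refl _) cd) (ole_refl _)).
Qed.

(** The bound reached after the removal of [n] points: the upper part of the
    order is stacked on the lower part, the successor making room for the
    removed point at the top of the lower part. *)
Fixpoint oexp_double (b : ord) (n : nat) : ord :=
  if n is m.+1 then oadd (osucc (oexp_double b m)) (oexp_double b m)
  else oexp omega b.

Lemma oexp_doubleS_gt b n : olt (oexp_double b n) (oexp_double b n.+1).
Proof. by apply/ole_succP; exact: ole_add_l. Qed.

Lemma oexp_double_lt b a n : olt b a -> olt (oexp_double b n) (oexp omega a).
Proof.
move=> ba; have /ole_succP b1 := oexp_gt0 omega b.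
have a1 := ole_lt_trans b1 (olt_oexp2l ba).
elim: n => [|n IH] /=; first exact: olt_oexp2l.
apply: oadd_lt_oexp => //; apply: ole_lt_trans (oadd_lt_oexp IH a1).
apply/ole_succP/(ole_lt_trans (oadd0 _).2)/olt_oadd2l.
by apply/olt_succP; exact: ole_refl.
Qed.

Lemma seq_argmax_ord (T : eqType) (r : T -> ord) (x : T) (s : seq T) :
  exists2 y, y \in x :: s & forall z, z \in x :: s -> ole (r z) (r y).
Proof.
elim: s x => [|x' s IH] x.
  exists x; first exact: mem_head.
  by move=> z; rewrite inE => /eqP ->; exact: ole_refl.
have [y ys ymax] := IH x'.
have [xy|yx] := ole_or_gt (r x) (r y).
  exists y; first by rewrite inE ys orbT.
  by move=> z; rewrite inE => /predU1P[->|/ymax].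
exists x; first exact: mem_head.
move=> z; rewrite inE => /predU1P[->|/ymax zy]; first exact: ole_refl.
exact: ole_trans zy (oltW yx).
Qed.

(** * Ranks relative to a subset *)

(** Only the smaller element is restricted to [S], so that the rank of any
    point, in [S] or not, measures the part of [S] strictly below it. *)
Definition le_on (W : Type) (le : W -> W -> Prop) (S : set W) (p q : W) :
  Prop := S p /\ le p q.

Lemma le_on_wf (W : Type) (le : W -> W -> Prop) (S : set W) :
  well_founded (strict le) -> well_founded (strict (le_on le S)).
Proof.
move=> wf p; elim: (wf p) => {}p _ IH.
by constructor=> q [[_ qp] nqp]; apply: IH.
Qed.

Definition rank_on (W : Type) (le : W -> W -> Prop)
    (wf : well_founded (strict le)) (S : set W) : W -> ord :=
  point_rank (le_on_wf S wf).

Lemma point_rank_leP (W : Type) (le : W -> W -> Prop)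
    (wf : well_founded (strict le)) p a :
  ole (point_rank wf p) a <->
  forall q, strict le q p -> olt (point_rank wf q) a.
Proof.
rewrite point_rankE; split=> [/osup_leP h q qp|h].
  exact/ole_succP/(h (exist _ q qp)).
by apply/osup_leP => -[q qp] /=; exact/ole_succP/h.
Qed.

Lemma point_rank_lt (W : Type) (le : W -> W -> Prop)
    (wf : well_founded (strict le)) p q :
  strict le q p -> olt (point_rank wf q) (point_rank wf p).
Proof. by move: q; apply/point_rank_leP; exact: ole_refl. Qed.

Lemma point_rank_lt_rank (W : Type) (le : W -> W -> Prop)
    (wf : well_founded (strict le)) p : olt (point_rank wf p) (rank wf).
Proof.
by apply/ole_succP; exact: (ole_sup (fun p => osucc (point_rank wf p))).
Qed.

(** The rank is the least strictly increasing map to the ordinals; [I] is an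
    initial set outside of which [f] need not be increasing. *)
Lemma point_rank_le_fun (W : Type) (le : W -> W -> Prop)
    (wf : well_founded (strict le)) (I : set W) (f : W -> ord) :
  (forall p q, I p -> strict le q p -> I q /\ olt (f q) (f p)) ->
  forall p, I p -> ole (point_rank wf p) (f p).
Proof.
move=> fI p; elim: (wf p) => {}p _ IH Ip; apply/point_rank_leP => q qp.
have [Iq fqp] := fI _ _ Ip qp.
exact: ole_lt_trans (IH _ qp Iq) fqp.
Qed.

Lemma rank_on_leP (W : Type) (le : W -> W -> Prop)
    (wf : well_founded (strict le)) S p a :
  ole (rank_on wf S p) a <->
  forall q, S q -> strict le q p -> olt (rank_on wf S q) a.
Proof.
split=> [/point_rank_leP h q Sq [qp nqp]|h]; first by apply: h; split.
by apply/point_rank_leP => q [[Sq qp] nqp]; apply: h.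
Qed.

Lemma rank_on_lt (W : Type) (le : W -> W -> Prop)
    (wf : well_founded (strict le)) S p q :
  S q -> strict le q p -> olt (rank_on wf S q) (rank_on wf S p).
Proof. by move: q; apply/rank_on_leP; exact: ole_refl. Qed.

Lemma rank_on_le_fun (W : Type) (le : W -> W -> Prop)
    (wf : well_founded (strict le)) (S I : set W) (f : W -> ord) :
  (forall p q, I p -> S q -> strict le q p -> I q /\ olt (f q) (f p)) ->
  forall p, I p -> ole (rank_on wf S p) (f p).
Proof.
move=> fI; apply: point_rank_le_fun => p q Ip [[Sq qp] nqp].
by apply: fI.
Qed.

(** * Compactness and derivatives *)

(** The cover is indexed by the points of the space, which suits all the
    applications below.  Near-covering is applied to the filter on finite
    sequences of points of [K] generated by the sets of all sequences that
    contain a given one: locally at [x], every sequence that contains [x] is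
    good enough. *)
Lemma compact_seq_cover (X : topologicalType) (K : set X) (V : X -> set X) :
  compact K -> (forall x, K x -> open (V x) /\ V x x) ->
  exists2 s : seq X, (forall x, x \in s -> K x) &
    forall z, K z -> exists2 x, x \in s & V x z.
Proof.
move=> /compact_near_coveringP cK KV.
pose F : set_system (seq X) := fun Q => exists2 s : seq X,
  (forall x, x \in s -> K x) &
  forall t : seq X, {subset s <= t} -> (forall x, x \in t -> K x) -> Q t.
have FF : Filter F.
  split; first by exists [::].
    move=> P Q [s sK sP] [t tK tQ]; exists (s ++ t).
      by move=> x; rewrite mem_cat => /orP[/sK|/tK].
    move=> r sr rK; split.
      by apply: sP => // x xs; apply: sr; rewrite mem_cat xs.
    by apply: tQ => // x xt; apply: sr; rewrite mem_cat xt orbT.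
  move=> P Q PQ [s sK sP]; exists s => // t st tK; exact/PQ/sP.
have [x Kx|s sK sV] := cK _ F (fun s z => exists2 x, x \in s & V x z) FF.
  have [oV Vx] := KV x Kx.
  exists (V x, [set s | x \in s]) => /=.
    split; first exact: open_nbhs_nbhs.
    exists [:: x] => [y|t]; first by rewrite inE => /eqP ->.
    by move=> /(_ x (mem_head _ _)).
  by move=> [z s] /= [Vz xs]; exists x.
by exists s => // z Kz; apply: sV.
Qed.

Lemma derived_closed (X : topologicalType) (A : set X) :
  closed A -> closed (derived A).
Proof.
move=> cA x xA.
have Ax : A x by apply: cA => V /xA [y [[Ay _] Vy]]; exists y.
split=> // -[_ [V Vx VA]].
move: (Vx); rewrite nbhsE => -[O [oO Ox] OV].
have [y [[Ay nAy] Oy]] := xA O (open_nbhs_nbhs (conj oO Ox)).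
have yx : [set x] y by rewrite -VA; split=> //; exact: OV.
by apply: nAy; rewrite yx; split; [exact/mem_set|exists V].
Qed.

Lemma cb_derivative_closed (X : topologicalType) a :
  closed (cb_derivative X a).
Proof.
elim: a => A f IH /=; apply: closed_bigI => i _.
exact: derived_closed.
Qed.

Lemma compact_isolated_finite (X : topologicalType) (K : set X) :
  compact K -> derived K `<=` set0 -> exists s : seq X, K `<=` [set` s].
Proof.
move=> cK dK.
have iso x : exists V : set X, K x -> [/\ open V, V x & V `&` K `<=` [set x]].
  have [Kx|] := pselect (K x); last by exists set0.
  have [_ [V + VK]] : isolated K x by apply: contrapT => nx; exact: (dK x).
  rewrite nbhsE => -[O [oO Ox] OV]; exists O => _; split=> //.
  by move=> y [/OV Vy Ky]; rewrite -VK.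
have [V VP] := choice iso.
have [|s sS sK] := @compact_seq_cover _ K V cK.
  by move=> x Kx; have [] := VP x Kx.
exists s => z Kz; have [x xs Vxz] := sK z Kz.
have [_ _ VK] := VP x (sS x xs).
by have -> : z = x by exact: VK.
Qed.

Lemma derived_sub0 (X : topologicalType) (K A : set X) :
  K `<=` A -> K `&` derived A `<=` set0 -> derived K `<=` set0.
Proof.
by move=> KA KdA x xK; apply: (KdA x); split; [case: xK|exact: derivedS xK].
Qed.

(** * Height and rank *)

Lemma cb_derivative_le_rank (X : topologicalType) (cX : compact [set: X])
    (U : X -> set X) (hU : clopen_selector U) (x : X) (a : ord) :
  cb_derivative X a x -> ole a (point_rank (sel_wf cX hU) x).
Proof.
elim: (sel_wf cX hU x) a => {}x _ IH [A f] /= xa.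
apply/ole_limP => i; have [xi nxi] := xa i I.
have [y [Uxy fy] yx] : exists2 y, (U x `&` cb_derivative X (f i)) y & y <> x.
  apply: contrapT => h; apply: nxi; split; first exact/mem_set.
  have [oU _] := selector_clopen hU x.
  exists (U x).
    exact: open_nbhs_nbhs (conj oU (selector_refl hU x)).
  apply/seteqP; split=> y; last by move=> ->; split=> //; exact: selector_refl.
  by move=> Uy; apply: contrapT => yx; apply: h; exists y.
have syx : strict (sel_le U) y x by split=> //; exact/(sel_leP hU).
exact: ole_lt_trans (IH y syx _ fy) (point_rank_lt _ syx).
Qed.

Lemma rank_on_initial (X : topologicalType) (cX : compact [set: X])
    (U : X -> set X) (hU : clopen_selector U) (L : set X) (p : X) :
  ole (rank_on (sel_wf cX hU) L p) (rank_on (sel_wf cX hU) (L `&` U p) p).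
Proof.
apply: (rank_on_le_fun _ (I := U p)); last exact: selector_refl.
move=> q r Uq Lr rq.
have Ur : U p r by apply: (selector_trans hU Uq); apply/(sel_leP hU); case: rq.
by split=> //; apply: rank_on_lt.
Qed.

(** The points of [s] are removed one by one. For [x] among them, let [T] be
    the bound for the sets avoiding [x]. Ranks in [L] of points of [U x] are at
    most [T], because the down-set of a point strictly below such a point
    avoids [x]; the points of [L `\` U x] are stacked above, starting from [T +
    1], and [L `\` U x] avoids [x] too. *)
Lemma rank_on_lt_double (X : topologicalType) (cX : compact [set: X])
    (U : X -> set X) (hU : clopen_selector U) (D : set X) (b : ord) :
  (forall L, clopen L -> L `&` D `<=` set0 -> forall p, L p ->
    olt (rank_on (sel_wf cX hU) L p) (oexp omega b)) ->
  forall (s : seq X) L, clopen L -> L `&` D `<=` [set` s] -> forall p, L p ->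
    olt (rank_on (sel_wf cX hU) L p) (oexp_double b (size s)).
Proof.
move=> base; elim=> [|x s IH] L cL Ls.
  by apply: base => // z /Ls.
have IHx M : clopen M -> M `<=` L -> ~ M x -> forall p, M p ->
    olt (rank_on (sel_wf cX hU) M p) (oexp_double b (size s)).
  move=> cM ML nMx; apply: IH => // z [Mz Dz].
  have /= := Ls z (conj (ML z Mz) Dz).
  by rewrite inE => /predU1P[zx|//]; rewrite zx in Mz.
(* If [q < p <= x] then [U q] omits [x], as otherwise [p <= x <= q]. *)
have low p : L p -> U x p ->
    ole (rank_on (sel_wf cX hU) L p) (oexp_double b (size s)).
  move=> Lp Uxp; apply/rank_on_leP => q Lq qp.
  apply: ole_lt_trans (rank_on_initial cX hU L q) _.
  apply: IHx; last by split=> //; exact: selector_refl.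
  - exact: clopenI cL (selector_clopen hU q).
  - by move=> z [].
  - move=> [_ Uqx]; apply: qp.2; apply: (sel_le_anti hU); first exact: qp.1.
    apply: subset_trans (selector_trans hU Uxp) _.
    exact: (selector_trans hU Uqx).
pose M := L `\` U x.
have cM : clopen M.
  rewrite /M setDE; apply: clopenI => //; exact: clopenC (selector_clopen hU x).
pose f p := if pselect (U x p) is left _ then rank_on (sel_wf cX hU) L p
  else oadd (osucc (oexp_double b (size s))) (rank_on (sel_wf cX hU) M p).
move=> p Lp; apply: (@ole_lt_trans _ (f p)).
  apply: (rank_on_le_fun _ (I := L)) Lp => {}p q Lp Lq qp; split=> //.
  rewrite /f; case: pselect => [Uq|nUq]; case: pselect => [Up|nUp].
  - exact: rank_on_lt.
  - apply: olt_le_trans (ole_add_l _ _); apply/olt_succP; exact: low.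
  - case: nUq; apply: (selector_trans hU Up).
    by apply/(sel_leP hU); exact: qp.1.
  - by apply: olt_oadd2l; exact: rank_on_lt.
rewrite /f; case: pselect => [Up|nUp].
  exact: ole_lt_trans (low _ Lp Up) (oexp_doubleS_gt b (size s)).
apply: olt_oadd2l; apply: IHx => //; first by move=> z [].
by case=> _ []; exact: selector_refl.
Qed.

(** The bound [c] is uniform over [L]: this is what makes the resulting
    inequality for the rank of the whole space strict. *)
Lemma rank_on_lt_oexp_cb (X : topologicalType) (cX : compact [set: X])
    (U : X -> set X) (hU : clopen_selector U) (a : ord) (L : set X) :
  clopen L -> L `&` cb_derivative X a `<=` set0 ->
  exists2 c, olt c (oexp omega a) &
    forall p, L p -> olt (rank_on (sel_wf cX hU) L p) c.
Proof.
elim: a L => A f IH L cL La.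
have [[x0 Lx0]|L0] := pselect (exists x, L x); last first.
  exists ozero; first exact: oexp_gt0.
  by move=> p Lp; case: L0; exists p.
have escL x : L x -> exists i, ~ derived (cb_derivative X (f i)) x.
  move=> Lx; apply: contrapT => nx; apply: (La x); split=> // i _.
  by apply: contrapT => ni; apply: nx; exists i.
have [i0 _] := escL x0 Lx0.
have esc x : exists i, L x -> ~ derived (cb_derivative X (f i)) x.
  by have [/escL[i]|] := pselect (L x); [exists i|exists i0].
have [g gP] := choice esc.
have cptL : compact L by exact: subclosed_compact cL.2 cX (fun _ _ => I).
have [|[|x s] sL sV] :=
  @compact_seq_cover _ L (fun x => ~` derived (cb_derivative X (f (g x)))) cptL.
- move=> x Lx; split; last exact: gP.
  exact/closed_openC/derived_closed/cb_derivative_closed.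
- by have [] := sV x0 Lx0.
(* The derivatives decrease, so the largest of the finitely many indices
   works for all of [L]. *)
have [y ys ymax] := seq_argmax_ord (f \o g) x s.
set b := f (g y).
have Lb : L `&` derived (cb_derivative X b) `<=` set0.
  move=> z [Lz dz]; have [w ws nz] := sV z Lz; apply: nz.
  by apply: derivedS dz; apply: cb_derivativeS; exact: ymax.
have ba : olt b (olim f) by exists (g y); exact: ole_refl.
have [||t Lt] := @compact_isolated_finite _ (L `&` cb_derivative X b).
- by apply: compact_closedI => //; exact: cb_derivative_closed.
- apply: (@derived_sub0 _ _ (cb_derivative X b)); first by move=> z [].
  by move=> z [[Lz _] dz]; apply: (Lb z).
exists (oexp_double b (size t)); first exact: oexp_double_lt.
apply: rank_on_lt_double Lt => // M cM Mb p Mp.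
have [c cb Mc] := IH (g y) M cM Mb.
exact: (@olt_le_trans _ c _ (Mc p Mp) (oltW cb)).
Qed.

Lemma rank_lt_oexp_height (X : topologicalType) (cX : compact [set: X])
    (U : X -> set X) (hU : clopen_selector U) :
  olt (rank (sel_wf cX hU)) (oexp omega (osucc (height X))).
Proof.
have [||c ca Xc] :=
  @rank_on_lt_oexp_cb X cX U hU (osucc (height X)) [set: X].
- exact: clopenT.
- move=> x [_ xh]; have [_] := point_heightP cX hU x; apply.
  apply: cb_derivativeS xh; apply/ole_succP/olt_succP.
  exact: ole_sup.
apply: ole_lt_trans ca; apply/osup_leP => p; apply/ole_succP.
apply: ole_lt_trans (Xc p I).
apply: (point_rank_le_fun _ (I := setT)) => // {}p q _ qp; split=> //.
exact: rank_on_lt.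
Qed.

(** * Rank of the hyperspace *)

Definition hyp_rank_above (X : topologicalType) (cX : compact [set: X])
    (U : X -> set X) (hU : clopen_selector U)
    (B : set X) : hyperspace U -> ord :=
  rank_on (hyp_wf cX hU) [set F | B `<=` hset F].

(** The points of [s], which are those possibly of rank at least [b], are
    removed one by one.  For [x] in [s], a member [F] of the interval from [B]
    to [G] either omits [x] or contains [B `|` U x], and in the latter case is
    measured relative to [B `|` U x], starting above the bound for the former
    ones. *)
Lemma hyp_rank_above_lt_double (X : topologicalType) (cX : compact [set: X])
    (U : X -> set X) (hU : clopen_selector U) (b : ord) :
  (forall (B : set X) (G : hyperspace U), open B -> B `<=` hset G ->
    (forall z, (hset G `\` B) z -> olt (point_rank (sel_wf cX hU) z) b) ->
    olt (hyp_rank_above cX hU B G) (oexp omega b)) ->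
  forall (s : seq X) (B : set X) (G : hyperspace U), open B -> B `<=` hset G ->
    (forall z, (hset G `\` B) z ->
      olt (point_rank (sel_wf cX hU) z) b \/ z \in s) ->
    olt (hyp_rank_above cX hU B G) (oexp_double b (size s)).
Proof.
move=> base; elim=> [|x s IH] B G oB BG Gs.
  by apply: base => // z /Gs[].
have IHx C F : open C -> B `<=` C -> C `<=` hset F -> hset F `<=` hset G ->
    ~ (hset F `\` C) x ->
    olt (hyp_rank_above cX hU C F) (oexp_double b (size s)).
  move=> oC BC CF FG nx; apply: IH => // z [Fz nCz].
  have [|zb|] := Gs z; [by split; [exact: FG|move=> /BC]|by left|].
  by rewrite inE => /predU1P[zx|]; [rewrite zx in Fz nCz; case: nx|right].
pose C := B `|` U x.
have oC : open C by apply: openU => //; have [] := selector_clopen hU x.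
have xC : C x by right; exact: selector_refl.
pose f F := if pselect (hset F x) is left _
  then oadd (osucc (oexp_double b (size s))) (hyp_rank_above cX hU C F)
  else hyp_rank_above cX hU B F.
pose I := [set F : hyperspace U | B `<=` hset F /\ hset F `<=` hset G].
have CF F : I F -> hset F x -> C `<=` hset F.
  move=> [BF _] Fx z [/BF//|Uxz]; apply: hset_initial Fx _.
  exact/(sel_leP hU).
have low F : I F -> ~ hset F x ->
    olt (hyp_rank_above cX hU B F) (oexp_double b (size s)).
  by move=> [BF FG] nFx; apply: IHx => // -[].
have IG : I G by split.
apply: (@ole_lt_trans _ (f G)).
  apply: (rank_on_le_fun _ (I := I)) => // F' F IF' BF FF'.
  have IF : I F by split=> //; apply: subset_trans IF'.2; exact: FF'.1.
  split=> //; rewrite /f.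
  case: pselect => [Fx|nFx]; case: pselect => [F'x|nF'x].
  - by apply: olt_oadd2l; apply: rank_on_lt => //; exact: CF.
  - by case: nF'x; exact: FF'.1.
  - apply: olt_le_trans (ole_add_l _ _); apply/olt_succP/oltW; exact: low.
  - exact: rank_on_lt.
rewrite /f; case: pselect => [Gx|nGx].
  apply: olt_oadd2l; apply: IHx => //; last by case.
  - by move=> z Bz; left.
  - exact: CF.
exact: ole_lt_trans (oltW (low _ IG nGx)) (oexp_doubleS_gt b (size s)).
Qed.

Lemma hyp_rank_above_lt_oexp (X : topologicalType) (cX : compact [set: X])
    (U : X -> set X) (hU : clopen_selector U)
    (a : ord) (B : set X) (G : hyperspace U) :
  open B -> B `<=` hset G ->
  (forall z, (hset G `\` B) z -> olt (point_rank (sel_wf cX hU) z) a) ->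
  olt (hyp_rank_above cX hU B G) (oexp omega a).
Proof.
elim: (olt_wf a) B G => {}a _ IH B G oB BG Ga.
have cGB : compact (hset G `\` B).
  apply: (subclosed_compact _ cX) => //.
  by rewrite setDE; apply: closedI; [exact: hset_closed|exact: open_closedC].
have [|[|x s] sGB sU] := @compact_seq_cover _ _ U cGB.
- move=> x _; split; last exact: selector_refl.
  by have [] := selector_clopen hU x.
- apply: ole_lt_trans (oexp_gt0 omega a); apply/rank_on_leP => F BF [FG nFG].
  case: nFG; apply: hyp_le_anti => // z Gz; apply: BF.
  by apply: contrapT => nBz; have [] := sU z.
have [y ys ymax] := seq_argmax_ord (point_rank (sel_wf cX hU)) x s.
have ya := Ga y (sGB y ys).
apply: ole_lt_trans (oltW _) (oexp_double_lt (size (x :: s)) ya).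
apply: hyp_rank_above_lt_double => //; first by move=> *; exact: IH.
move=> z GBz; have [w ws Uwz] := sU z GBz.
(* A point of [U w] other than [w] has a rank smaller than that of [w]. *)
have [<-|zw] := pselect (w = z); first by right.
left; apply: olt_le_trans (ymax w ws); apply: point_rank_lt.
by split; [exact/(sel_leP hU)|move=> zw'; apply: zw].
Qed.

Lemma rank_hyp_le_oexp (X : topologicalType) (cX : compact [set: X])
    (U : X -> set X) (hU : clopen_selector U) :
  ole (rank (hyp_wf cX hU)) (oexp omega (rank (sel_wf cX hU))).
Proof.
apply/osup_leP => G; apply/ole_succP.
apply: (@ole_lt_trans _ (hyp_rank_above cX hU set0 G)).
  apply: (point_rank_le_fun _ (I := setT)) => // F' F _ FF'; split=> //.
  by apply: rank_on_lt.
apply: hyp_rank_above_lt_oexp => //; first exact: open0.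
by move=> z _; exact: point_rank_lt_rank.
Qed.

Theorem theorem3 (X : topologicalType) (skX : skula X)
    (cX : compact [set: X]) (U : X -> set X) (hU : clopen_selector U) :
  (ole (height X) (rank (sel_wf cX hU)) /\
   olt (rank (sel_wf cX hU)) (oexp omega (osucc (height X)))) /\
  ole (rank (hyp_wf cX hU)) (oexp omega (rank (sel_wf cX hU))).
Proof.
split; last exact: rank_hyp_le_oexp.
split; last exact: rank_lt_oexp_height.
apply/osup_leP => x; have [hx _] := point_heightP cX hU x.
apply: ole_trans (cb_derivative_le_rank cX hU hx) (oltW _).
exact: point_rank_lt_rank.
Qed.
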